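(* Let $G$ and $\overline{G}$ be twin parsimonious games, with minimal winning quotas $q$ and $\overline{q}$ respectively. Then $q=\overline{q}$.
   Context: A constant sum homogeneous weighted majority game on a finite player set $N$ is a simple game ($v(S)\in\{0,1\}$ for every $S\subseteq N$), constant sum ($v(S)+v(N\setminus S)=1$), admitting a (unique) minimal homogeneous representation $(q,\mathbf{w})$: the individual weights $w_j$ are integers in nondecreasing order, some players have weight $1$, $v(S)=1$ if and only if $w(S):=\sum_{j\in S}w_j\ge q$, with $q=\frac{1+w(N)}{2}$, and $w(S)=q$ for every minimal winning coalition $S$ (a coalition with $v(S)=1$ and $v(T)=0$ for all $T\subsetneq S$). The number $q$ is the minimal winning quota of the game. A parsimonious game ($P$ game) is a constant sum homogeneous weighted majority game with $n>3$ players, none of them dummy, having exactly $n$ minimal winning coalitions (the smallest possible number). Recalled facts about $P$ games (known, due to earlier work). Group the players by equal weight in the minimal homogeneous representation into $h$ types ($2\le h\le n-2$) with type weights $w_1<w_2<\cdots<w_h$, and let $x_t\geq 1$ be the number of players of type $t$. Then $x_1>1$, $x_{h-1}>1$, $x_h=1$. The vector $(x_1,\ldots,x_h)$ is the type representation, and $(x_1,\ldots,x_{h-1})$ is the free type representation; it determines the game. With the convention $w_0=0$, the type weights satisfy $w_1=1$, $w_t=x_{t-1}w_{t-1}+w_{t-2}$ for $1<t<h$, and $w_h=(x_{h-1}-1)w_{h-1}+w_{h-2}$. Two $P$ games $G$ and $\overline{G}$ are twin games (twins) if their free type representations have the same length $h-1$, are not identical, and are symmetric to each other: if they are $(x_1,\ldots,x_{h-1})$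 and $(\overline{x}_1,\ldots,\overline{x}_{h-1})$, then $x_t=\overline{x}_{h-t}$ for all $t=1,\ldots,h-1$. *)

(* Defs.v *)
From mathcomp Require Import all_boot all_order all_algebra.

Set Implicit Arguments.
Unset Strict Implicit.
Unset Printing Implicit Defensive.

Import Order.TTheory GRing.Theory Num.Theory.
Local Open Scope ring_scope.

(* v S = true means v(S) = 1, i.e. S is winning; monotonicity and v set0 = false
   are not imposed, they follow for weighted games without dummies. *)
Definition simple_game (N : finType) := {set N} -> bool.

Definition constant_sum (N : finType) (v : simple_game N) : Prop :=
  forall S : {set N}, (v S + v (~: S) = 1)%N.

Definition minimal_winning (N : finType) (v : simple_game N) : pred {set N} :=
  minset v.

Definition coalition_weight (N : finType) (w : N -> int) (S : {set N}) : int :=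
  \sum_(j in S) w j.

(* Players are not numbered, so the convention that weights are listed in
   nondecreasing order appears only in type_weights below. *)
Definition minimal_homogeneous_representation (N : finType)
    (v : simple_game N) (q : int) (w : N -> int) : Prop :=
  [/\ exists j, w j = 1,
      forall S : {set N}, v S = (q <= coalition_weight w S),
      q *+ 2 = 1 + coalition_weight w [set: N]
    & forall S : {set N}, minimal_winning v S -> coalition_weight w S = q].

Definition constant_sum_homogeneous (N : finType) (v : simple_game N) : Prop :=
  constant_sum v /\ exists q w, minimal_homogeneous_representation v q w.

Definition minimal_winning_quota (N : finType) (v : simple_game N) (q : int) :
    Prop :=
  exists w, minimal_homogeneous_representation v q w.

Definition dummy (N : finType) (v : simple_game N) (j : N) : Prop :=
  forall S : {set N}, minimal_winning v S -> j \notin S.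

Definition parsimonious (N : finType) (v : simple_game N) : Prop :=
  [/\ constant_sum_homogeneous v,
      (3 < #|N|)%N,
      forall j : N, ~ dummy v j
    & #|[set S : {set N} | minimal_winning v S]| = #|N|].

Definition type_weights (N : finType) (w : N -> int) : seq int :=
  sort <=%R (undup (codom w)).

Definition type_vector (N : finType) (w : N -> int) : seq nat :=
  [seq #|[set j | w j == a]| | a <- type_weights w].

(* (x_1, ..., x_(h-1)): the last entry x_h is dropped. *)
Definition free_type_vector (N : finType) (w : N -> int) : seq nat :=
  take (size (type_vector w)).-1 (type_vector w).

Definition free_type_representation (N : finType) (v : simple_game N)
    (x : seq nat) : Prop :=
  exists q w, minimal_homogeneous_representation v q w /\ x = free_type_vector w.

(* Entry t of a sequence is x_(t+1), so x_t = y_(h-t) pairs the indices t and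
   size x - t.+1. *)
Definition twins (N N' : finType) (v : simple_game N) (v' : simple_game N') :
    Prop :=
  exists x y : seq nat,
    [/\ free_type_representation v x, free_type_representation v' y,
        size x = size y, x <> y
      & forall t, (t < size x)%N -> nth 0%N x t = nth 0%N y (size x - t.+1)].

(* Main.v *)
(* Order the players by decreasing weight and build winning coalitions of weight
   q by deciding for each player in turn whether to include it; a state is the
   weight r still to be collected from a suffix of the player list.  Homogeneity
   forbids overshooting, so every decision to include is safe, and
   complementation of coalitions (2q = 1 + w(N)) pairs the states r, r' of a
   suffix s by r + r' = w(s) + 1.  Since no player is dummy, each player but the
   last forces a branching, so there are at least n minimal winning coalitions.
   With exactly n of them, each proper suffix x :: s has just the two states w(x)
   and w(s) + 1.  Going one player further, w(x) = w(y) or w(x) = w(s'') + 1,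
   where s = y :: s''; this is the recursion of the type weights.  It makes q the
   continuant of the free type representation, and continuants are invariant
   under reversal.  The same descent shows that the equations w(S) = q determine
   w up to a factor, hence that q depends on the game only. *)
Require Import Defs.
From mathcomp Require Import all_boot all_order all_algebra.
From mathcomp Require Import zify ring.

Set Implicit Arguments.
Unset Strict Implicit.
Unset Printing Implicit Defensive.

Import Order.TTheory GRing.Theory Num.Theory.
Local Open Scope ring_scope.

(** * Weights of coalitions and of lists *)

Lemma coalition_weightU1 (T : finType) (w : T -> int) (i : T) (S : {set T}) :
  i \notin S -> coalition_weight w (i |: S) = w i + coalition_weight w S.
Proof. by move=> iS; rewrite /coalition_weight big_setU1. Qed.

Lemma coalition_weightD1 (T : finType) (w : T -> int) (i : T) (S : {set T}) :
  i \in S -> coalition_weight w S = w i + coalition_weight w (S :\ i).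
Proof. by move=> iS; rewrite /coalition_weight (big_setD1 i). Qed.

Lemma coalition_weight0 (T : finType) (w : T -> int) :
  coalition_weight w set0 = 0.
Proof. by rewrite /coalition_weight big_set0. Qed.

Lemma coalition_weight_ge0 (T : finType) (w : T -> int) (S : {set T}) :
  (forall i, 0 < w i) -> 0 <= coalition_weight w S.
Proof. by move=> w_gt0; apply: sumr_ge0 => i _; apply: ltW. Qed.

Lemma coalition_weight_gt0 (T : finType) (w : T -> int) (i : T) (S : {set T}) :
  (forall i, 0 < w i) -> i \in S -> 0 < coalition_weight w S.
Proof.
move=> w_gt0 iS; rewrite (coalition_weightD1 _ iS).
have := coalition_weight_ge0 (S :\ i) w_gt0; have := w_gt0 i; lia.
Qed.

Lemma coalition_weight_subset (T : finType) (w : T -> int) (A B : {set T}) :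
  (forall i, 0 < w i) -> A \subset B ->
  coalition_weight w A <= coalition_weight w B.
Proof.
move=> w_gt0 AB; rewrite /coalition_weight [leRHS](big_setID A) /=.
by rewrite (setIidPr AB) lerDl; apply: sumr_ge0 => i _; apply: ltW.
Qed.

Definition weight_sum (a : seq int) : int := \sum_(x <- a) x.

Lemma weight_sum_cons (x : int) (a : seq int) :
  weight_sum (x :: a) = x + weight_sum a.
Proof. exact: big_cons. Qed.

Lemma coalition_weight_le_sum (T : finType) (w : T -> int) (s : seq T)
    (S : {set T}) :
  (forall i, 0 < w i) -> uniq s -> S \subset s ->
  coalition_weight w S <= weight_sum (map w s).
Proof.
move=> w_gt0 us Ss; rewrite /weight_sum big_map (big_uniq _ us) /=.
have -> : \sum_(i in s) w i = coalition_weight w [set i in s].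
  by apply: eq_bigl => i; rewrite inE.
apply: coalition_weight_subset => //.
by apply/subsetP => i /(subsetP Ss); rewrite inE.
Qed.

(** * Counting the coalitions of prescribed weight inside a list of players *)

Definition solutions (T : finType) (w : T -> int) (s : seq T) (r : int) :
    {set {set T}} :=
  [set S : {set T} | (S \subset s) && (coalition_weight w S == r)].

Definition nsolutions (T : finType) (w : T -> int) (s : seq T) (r : int) : nat :=
  #|solutions w s r|.

Lemma solutionsP (T : finType) (w : T -> int) (s : seq T) (r : int)
    (S : {set T}) :
  reflect (S \subset s /\ coalition_weight w S = r) (S \in solutions w s r).
Proof. by rewrite inE; apply: (iffP andP) => -[-> /eqP]. Qed.

Lemma subset_cons (T : finType) (i : T) (s : seq T) (S : {set T}) :
  (S \subset i :: s) = (S :\ i \subset s).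
Proof.
apply/subsetP/subsetP => [Ss j | Ss j jS].
  by rewrite !inE => /andP[ji /Ss]; rewrite inE (negPf ji).
by rewrite inE; case: eqVneq => //= ji; apply: Ss; rewrite !inE ji.
Qed.

Lemma subset_consW (T : finType) (i : T) (s : seq T) (S : {set T}) :
  S \subset s -> S \subset i :: s.
Proof.
by move=> Ss; apply/subsetP => j /(subsetP Ss) js; rewrite inE js orbT.
Qed.

Lemma subset_setU1_cons (T : finType) (i : T) (s : seq T) (S : {set T}) :
  S \subset s -> i |: S \subset i :: s.
Proof.
move=> Ss; apply/subsetP => j; rewrite !inE.
by case: eqP => //= _ /(subsetP Ss).
Qed.

Lemma subset_set1_cons (T : finType) (i : T) (s : seq T) :
  [set i] \subset i :: s.
Proof. by apply/subsetP => j; rewrite !inE => /eqP->; rewrite eqxx. Qed.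

Lemma notin_subset (T : finType) (i : T) (s : seq T) (S : {set T}) :
  i \notin s -> S \subset s -> i \notin S.
Proof. by move=> + /subsetP Ss; apply: contra => /Ss. Qed.

Lemma setD1_notin (T : finType) (i : T) (S : {set T}) :
  i \notin S -> S :\ i = S.
Proof. by move=> iS; apply/setDidPl; rewrite disjoint_sym disjoints1. Qed.

(** Split by membership of [i]; adjoining [i] is injective on coalitions that miss it. *)
Lemma nsolutions_cons (T : finType) (w : T -> int) (i : T) (s : seq T)
    (r : int) :
  i \notin s ->
  nsolutions w (i :: s) r
    = (nsolutions w s (r - w i) + nsolutions w s r)%N.
Proof.
move=> nis; rewrite /nsolutions -(cardsID [set S : {set T} | i \in S]); congr addn.
  rewrite -(card_in_imset (f := fun S => i |: S) (D := solutions w s (r - w i))).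
    apply: eq_card => S; rewrite in_setI [X in _ && X]in_set.
    apply/andP/imsetP => [[/solutionsP[Ss wS] iS] | [U /solutionsP[Us wU] ->]].
      exists (S :\ i); last by rewrite setD1K.
      apply/solutionsP; split; first by rewrite -subset_cons.
      by rewrite -wS (coalition_weightD1 _ iS) addrC addKr.
    split; last by rewrite !inE eqxx.
    apply/solutionsP; split; first exact: subset_setU1_cons.
    by rewrite coalition_weightU1 ?(notin_subset nis) // wU addrC subrK.
  move=> A B /solutionsP[As _] /solutionsP[Bs _] /(congr1 (fun S => S :\ i)).
  by rewrite !setU1K ?(notin_subset nis).
apply: eq_card => S; rewrite in_setD [X in ~~ X]in_set.
apply/andP/solutionsP => [[niS /solutionsP[Ss wS]] | [Ss wS]].
  by split=> //; move: Ss; rewrite subset_cons setD1_notin.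
split; first exact: notin_subset Ss.
by apply/solutionsP; split=> //; apply: subset_consW.
Qed.

Lemma nsolutions0 (T : finType) (w : T -> int) (s : seq T) :
  (forall i, 0 < w i) -> nsolutions w s 0 = 1%N.
Proof.
move=> w_gt0; rewrite /nsolutions -(cards1 (set0 : {set T})); apply: eq_card => S.
rewrite [RHS]inE; apply/solutionsP/eqP => [[_ wS] | ->].
  apply/eqP; apply/set0Pn => -[i /(coalition_weight_gt0 w_gt0)].
  by rewrite wS ltxx.
by rewrite coalition_weight0; split=> //; apply/subsetP => j; rewrite inE.
Qed.

Lemma nsolutions_gt_sum (T : finType) (w : T -> int) (s : seq T) (r : int) :
  (forall i, 0 < w i) -> uniq s -> weight_sum (map w s) < r ->
  nsolutions w s r = 0%N.
Proof.
move=> w_gt0 us lt_r; apply/eqP; rewrite /nsolutions cards_eq0; apply/set0Pn => -[S].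
case/solutionsP => Ss wS; have := coalition_weight_le_sum w_gt0 us Ss; lia.
Qed.

(** * Homogeneity along a list of decreasing weights *)

(* i is a lightest player of S: a coalition completed in order of decreasing
   weight cannot jump over r. *)
Definition homogeneous_on (T : finType) (w : T -> int) (s : seq T) (r : int) :
    Prop :=
  forall (S : {set T}) (i : T), S \subset s -> i \in S ->
    (forall j, j \in S -> w i <= w j) ->
    coalition_weight w (S :\ i) < r -> coalition_weight w S <= r.

Lemma homogeneous_on_tail (T : finType) (w : T -> int) (x : T) (s : seq T)
    (r : int) :
  homogeneous_on w (x :: s) r -> homogeneous_on w s r.
Proof. by move=> hom S i Ss; apply: hom; apply: subset_consW. Qed.

Definition heavier (T : finType) (w : T -> int) : rel T := fun i j => w j <= w i.

Lemma heavier_trans (T : finType) (w : T -> int) : transitive (heavier w).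
Proof. by move=> j i k ji kj; apply: le_trans kj ji. Qed.

Lemma sorted_heavier_head (T : finType) (w : T -> int) (x : T) (s : seq T) :
  sorted (heavier w) (x :: s) -> forall i, i \in s -> w i <= w x.
Proof.
by move=> /(order_path_min (@heavier_trans _ w))/allP le_x i /le_x.
Qed.

(** As [x] is at least as heavy as all of [s], a lightest player of [S] stays lightest in
    [x |: S]. *)
Lemma homogeneous_on_take (T : finType) (w : T -> int) (x : T) (s : seq T)
    (r : int) :
  x \notin s -> sorted (heavier w) (x :: s) ->
  homogeneous_on w (x :: s) r -> homogeneous_on w s (r - w x).
Proof.
move=> nxs ss hom S i Ss iS min_i.
have nxS := notin_subset nxs Ss.
have xi : x != i by apply: contraNneq nxS => ->.
have := hom (x |: S) i (subset_setU1_cons _ Ss).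
rewrite setU1r // coalition_weightU1 // => /(_ isT).
have -> : (x |: S) :\ i = x |: (S :\ i).
  by apply/setP => j; rewrite !inE; case: eqVneq => // ->; case: eqVneq xi.
rewrite coalition_weightU1 ?inE ?(negPf nxS) ?andbF // => hom' lt_r.
suff /hom' : forall j, j \in x |: S -> w i <= w j by lia.
move=> j; rewrite !inE => /predU1P[-> |]; last exact: min_i.
by apply: (sorted_heavier_head ss); apply: (subsetP Ss).
Qed.

Lemma homogeneous_on_head (T : finType) (w : T -> int) (x : T) (s : seq T)
    (r : int) :
  0 < r -> homogeneous_on w (x :: s) r -> w x <= r.
Proof.
move=> r_gt0 /(_ [set x] x); rewrite /coalition_weight big_set1.
rewrite setDv big_set0; apply; rewrite ?set11 //.
  exact: subset_set1_cons.
by move=> j; rewrite inE => /eqP->.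
Qed.

(** * Lower bound on the solutions of a complementary pair of states *)

(* If x = weight_sum b + 1 then homogeneity leaves no use for the players of b:
   both states of the suffix x :: b equal x. *)
Fixpoint nondegenerate (a : seq int) : bool :=
  if a is x :: b then
    ((b == [::]) || (x != weight_sum b + 1)) && nondegenerate b
  else true.

(** The recursion [w_t = x_(t-1) w_(t-1) + w_(t-2)] in summed form, player by player: a weight
    repeats the next one or exceeds by one the sum of those beyond the next. *)
Fixpoint chain (a : seq int) : bool :=
  if a is x :: b then
    (if b is y :: c then (x == y) || (x == weight_sum c + 1) else x == 1)
    && chain b
  else true.

Definition solvable_with_last (T : finType) (w : T -> int) (z : T) (s : seq T)
    (r : int) : Prop :=
  exists2 S, S \in solutions w s r & last z s \in S.

(* [last z s] is the lightest player, common to all suffixes. *)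
Lemma nondegenerate_of_solvable (T : finType) (w : T -> int) (z : T)
    (s : seq T) (r1 r2 : int) :
  (forall i, 0 < w i) -> uniq s -> sorted (heavier w) s ->
  0 < r1 -> 0 < r2 -> r1 + r2 = weight_sum (map w s) + 1 ->
  homogeneous_on w s r1 -> homogeneous_on w s r2 ->
  solvable_with_last w z s r1 -> nondegenerate (map w s).
Proof.
move=> w_gt0; elim: s z r1 r2 => //= x s IHs z r1 r2 /andP[nxs us] ss.
move=> r1_gt0 r2_gt0; rewrite weight_sum_cons => r12 hom1 hom2.
move=> [S /solutionsP[Ss wS]].
case: (eqVneq s [::]) => [-> // | s_neq0] lastS.
have last_s : last x s \in s.
  case: s s_neq0 {IHs nxs us ss r12 hom1 hom2 Ss lastS} => //= y t _.
  exact: mem_last.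
have x_last : last x s != x by apply: contraNneq nxs => <-.
have x_le1 := homogeneous_on_head r1_gt0 hom1.
have x_le2 := homogeneous_on_head r2_gt0 hom2.
have ss' := path_sorted ss.
have lastS' : last x s \in S :\ x by rewrite !inE x_last.
have Ss' : S :\ x \subset s by rewrite -subset_cons.
have := coalition_weight_gt0 w_gt0 lastS'.
have := coalition_weight_le_sum w_gt0 us Ss'.
have hom1' := homogeneous_on_take nxs ss hom1.
have hom2' := homogeneous_on_take nxs ss hom2.
have sol r : coalition_weight w (S :\ x) = r -> solvable_with_last w x s r.
  by move=> wr; exists (S :\ x) => //; apply/solutionsP.
(* If [w x] were the tail sum plus one, both [r1] and [r2] would equal [w x]. But [S] weighs more
   than [w x] if it contains [x], since it also contains the last player, and at most the tail sum
   otherwise. *)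
case: (boolP (x \in S)) => xS.
  rewrite -wS (coalition_weightD1 _ xS) in x_le1 r12 hom1' *.
  move=> le_sum gt0; apply/andP; split.
    by apply/orP; right; apply/eqP; clear -x_le1 x_le2 r12 gt0; lia.
  apply: (IHs x (coalition_weight w (S :\ x)) r2) => //.
  - by clear -r12; lia.
  - by move: hom1'; rewrite addrC addKr.
  - exact: homogeneous_on_tail hom2.
  - exact: sol.
rewrite setD1_notin // in sol *; rewrite wS => le_sum _.
apply/andP; split.
  by apply/orP; right; apply/eqP; clear -x_le1 x_le2 r12 le_sum; lia.
apply: (IHs x r1 (r2 - w x)) => //.
- by clear -r12 le_sum; lia.
- by clear -r12; lia.
- exact: homogeneous_on_tail hom1.
- exact: sol.
Qed.

Lemma nondegenerate_head (T : finType) (w : T -> int) (x : T) (s : seq T) :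
  nondegenerate (map w (x :: s)) -> s != [::] ->
  w x <> weight_sum (map w s) + 1.
Proof.
by rewrite /= => /andP[+ _]; case: s => //= y s /eqP.
Qed.

(* The pair (r1, r2) passes to (r1, r2 - w x) and (r1 - w x, r2) on the tail; if
   r1 = w x, the second pair is replaced by the single solution [set x]. *)
Lemma nsolutions_pair_ge (T : finType) (w : T -> int) (s : seq T)
    (r1 r2 : int) :
  (forall i, 0 < w i) -> uniq s -> sorted (heavier w) s ->
  nondegenerate (map w s) ->
  0 < r1 -> 0 < r2 -> r1 + r2 = weight_sum (map w s) + 1 ->
  homogeneous_on w s r1 -> homogeneous_on w s r2 ->
  (size s < nsolutions w s r1 + nsolutions w s r2)%N.
Proof.
move=> w_gt0; elim: s r1 r2 => [|x s IHs] r1 r2.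
  by rewrite /weight_sum big_nil => *; lia.
move=> us ss nondeg; have [nxs us'] := andP us.
have nondeg' : nondegenerate (map w s) by case/andP: nondeg.
have ss' := path_sorted ss.
wlog le12 : r1 r2 / r1 <= r2 => [sym r1_gt0 r2_gt0 r12 hom1 hom2 | ].
  case: (leP r1 r2) => [|/ltW] le12; first exact: sym.
  by rewrite addnC; apply: sym => //; rewrite addrC.
rewrite map_cons weight_sum_cons => r1_gt0 r2_gt0 r12 hom1 hom2.
have x_le1 := homogeneous_on_head r1_gt0 hom1.
have x_gt0 := w_gt0 x.
have hom1' := homogeneous_on_take nxs ss hom1.
have hom2' := homogeneous_on_take nxs ss hom2.
have hom1t := homogeneous_on_tail hom1.
have hom2t := homogeneous_on_tail hom2.
have c0 := nsolutions0 s w_gt0.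
rewrite !nsolutions_cons //=.
have [s0 | s_neq0] := eqVneq s [::].
  move: r12; rewrite s0 /weight_sum big_nil => r12.
  have -> : r1 - w x = 0 by lia.
  have -> : r2 - w x = 0 by lia.
  by rewrite -s0 c0 s0 /=; lia.
have s_gt0 : (0 < size s)%N by rewrite lt0n size_eq0.
have neq_x := nondegenerate_head nondeg s_neq0.
(* By [le12], [r2 = w x] would give [r1 = w x] too, which [neq_x] excludes; so [r2 - w x] is
   positive. *)
have IH2 : (size s < nsolutions w s r1 + nsolutions w s (r2 - w x))%N.
  by apply: IHs => //; lia.
have [e1 | n1] := eqVneq r1 (w x); first by move: IH2; rewrite e1 subrr c0; lia.
have IH1 : (size s < nsolutions w s (r1 - w x) + nsolutions w s r2)%N.
  by apply: IHs => //; lia.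
lia.
Qed.

(** * The extremal case of the lower bound *)

Definition weighs_solutions (T : finType) (w f : T -> int) (s : seq T)
    (r p : int) : Prop :=
  forall S, S \in solutions w s r -> coalition_weight f S = p.

(** Equality in [nsolutions_pair_ge] leaves a single descent at each player, which fixes the
    weights. A second weighting [f], constant on the solutions of each state, is carried along the
    same descent and comes out proportional to [w]. *)
Lemma chain_of_nsolutions_pair (T : finType) (w f : T -> int) (x : T)
    (s : seq T) (r1 r2 p1 p2 : int) :
  (forall i, 0 < w i) -> uniq (x :: s) -> sorted (heavier w) (x :: s) ->
  nondegenerate (map w (x :: s)) ->
  0 < r1 -> 0 < r2 -> r1 + r2 = weight_sum (map w (x :: s)) + 1 ->
  homogeneous_on w (x :: s) r1 -> homogeneous_on w (x :: s) r2 ->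
  (nsolutions w (x :: s) r1 + nsolutions w (x :: s) r2 = (size s).+2)%N ->
  weighs_solutions w f (x :: s) r1 p1 -> weighs_solutions w f (x :: s) r2 p2 ->
  [/\ chain (map w (x :: s)),
      r1 = w x \/ r2 = w x
    & exists c : int, [/\ {in x :: s, forall i, f i = c * w i},
                    p1 = c * r1 & p2 = c * r2]].
Proof.
move=> w_gt0; elim: s x r1 r2 p1 p2 => [|y s IHs] x r1 r2 p1 p2;
    move=> us ss nondeg.
  rewrite map_cons weight_sum_cons {1}/weight_sum big_nil.
  move=> r1_gt0 r2_gt0 r12 hom1 hom2 _ f1 f2.
  have x_le1 := homogeneous_on_head r1_gt0 hom1.
  have x_le2 := homogeneous_on_head r2_gt0 hom2.
  have x_gt0 := w_gt0 x.
  have x1 : w x = 1 by lia.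
  have sol1 : [set x] \in solutions w [:: x] 1.
    apply/solutionsP; split; last by rewrite /coalition_weight big_set1.
    exact: subset_set1_cons.
  have e1 : r1 = 1 by lia.
  have e2 : r2 = 1 by lia.
  rewrite e1 in f1 *; rewrite e2 in f2 *.
  split; first by rewrite /= x1.
    by left.
  exists (f x); rewrite -(f1 _ sol1) -(f2 _ sol1) /coalition_weight big_set1.
  by rewrite mulr1; split=> // i; rewrite inE => /eqP->; rewrite x1 mulr1.
wlog le12 : r1 r2 p1 p2 / r1 <= r2
    => [sym r1_gt0 r2_gt0 r12 hom1 hom2 cnt f1 f2 | ].
  case: (leP r1 r2) => [|/ltW] le12; first exact: sym.
  have [||c1 c2 [c [c3 c4 c5]]] :=
    sym _ _ _ _ le12 r2_gt0 r1_gt0 _ hom2 hom1 _ f2 f1.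
  - by rewrite addrC.
  - by rewrite addnC.
  by split=> //; [case: c2; [right | left] | exists c].
have [nxs us'] : x \notin y :: s /\ uniq (y :: s) by apply/andP.
have ss' := path_sorted ss.
have nondeg' : nondegenerate (map w (y :: s)) by case/andP: nondeg.
rewrite map_cons weight_sum_cons => r1_gt0 r2_gt0 r12 hom1 hom2 cnt f1 f2.
have x_le1 := homogeneous_on_head r1_gt0 hom1.
have x_gt0 := w_gt0 x.
have hom1' := homogeneous_on_take nxs ss hom1.
have hom2' := homogeneous_on_take nxs ss hom2.
have hom1t := homogeneous_on_tail hom1.
have hom2t := homogeneous_on_tail hom2.
have c0 := nsolutions0 (y :: s) w_gt0.
have neq_x := nondegenerate_head nondeg isT.
rewrite !(nsolutions_cons _ _ nxs) -[size _]/(size s).+1 in cnt.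
(* Otherwise both descents are available, each with at least [size s + 2] solutions, against a total
   of [size s + 3]. *)
have e1 : r1 = w x.
  apply/eqP/negP => /negP n1.
  have ge1 : ((size s).+1 < nsolutions w (y :: s) (r1 - w x)
                             + nsolutions w (y :: s) r2)%N.
    by apply: (nsolutions_pair_ge w_gt0 us' ss' nondeg'); lia || assumption.
  have ge2 : ((size s).+1 < nsolutions w (y :: s) r1
                             + nsolutions w (y :: s) (r2 - w x))%N.
    by apply: (nsolutions_pair_ge w_gt0 us' ss' nondeg'); lia || assumption.
  by clear -cnt ge1 ge2; lia.
(* Now [r2] is the tail sum plus one, so every solution for [r2] contains [x]. *)
move: cnt; rewrite e1 subrr c0 (nsolutions_gt_sum (r := r2) w_gt0 us').
  2: by lia.
rewrite e1 in hom1t r1_gt0 r12 f1 *.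
move=> cnt.
have solx : [set x] \in solutions w [:: x, y & s] (w x).
  apply/solutionsP; split; last by rewrite /coalition_weight big_set1.
  exact: subset_set1_cons.
have fx : f x = p1 by rewrite -(f1 _ solx) /coalition_weight big_set1.
have f1' : weighs_solutions w f (y :: s) (w x) p1.
  move=> S /solutionsP[Ss wS]; apply/f1/solutionsP.
  by split; first exact: subset_consW.
have f2' : weighs_solutions w f (y :: s) (r2 - w x) (p2 - p1).
  move=> S /solutionsP[Ss wS]; have nxS := notin_subset nxs Ss.
  have solS : x |: S \in solutions w [:: x, y & s] r2.
    apply/solutionsP; split; first exact: subset_setU1_cons.
    by rewrite coalition_weightU1 // wS addrC subrK.
  have := f2 _ solS; rewrite coalition_weightU1 // fx => <-.
  by rewrite addrC addKr.
have [|||ch hd [c [fc pc1 pc2]]] := IHs y (w x) (r2 - w x) p1 (p2 - p1) us' ss'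
  nondeg' r1_gt0 _ _ hom1t hom2' _ f1' f2'; try by lia.
split; last first.
- exists c; split=> //; last by move: pc2; rewrite mulrBr pc1; lia.
  by move=> i; rewrite inE => /predU1P[-> | /fc //]; rewrite fx.
- by left.
rewrite map_cons /= in ch *; rewrite ch andbT.
(* In the remaining case [r2 - w x = w y], and [r2] is the tail sum plus one. *)
case: hd => [-> | hd]; first by rewrite eqxx.
by apply/orP; right; apply/eqP; move: r12; rewrite map_cons weight_sum_cons; lia.
Qed.

(** * Continuants and the counts of equal weights *)

(** The state is a pair of consecutive continuants, the later one first; it starts at [(1, 0)]. *)
Definition continuant_step (u : int * int) (n : nat) : int * int :=
  (n%:R * u.1 + u.2, u.1).

Definition continuant (ns : seq nat) : int := (foldl continuant_step (1, 0) ns).1.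

(** A continuant is a diagonal entry of a product of symmetric matrices, and reversal transposes the
    product. *)
Lemma continuant_rev (ns : seq nat) : continuant (rev ns) = continuant ns.
Proof.
pose dot (u v : int * int) := u.1 * v.1 + u.2 * v.2.
(* [continuant_step _ n] is the symmetric matrix [[n, 1], [1, 0]]. *)
have adj u v : dot (foldl continuant_step u ns) v
             = dot u (foldr (fun n u => continuant_step u n) v ns).
  elim: ns u => //= n ns IHns u; rewrite IHns /dot /=.
  by case: (foldr _ _ _) => a b /=; ring.
rewrite /continuant foldl_rev; have := adj (1, 0) (1, 0).
by rewrite /dot /= !mulr0 !addr0 mulr1 mul1r mul0r addr0.
Qed.

Definition counts (a : seq int) : seq nat :=
  [seq count_mem x a | x <- sort <=%R (undup a)].

(** A maximal [x] owns the last count. Deleting its copies from [a] treats a repeated weight and a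
    new one alike. *)
Lemma counts_cons (x : int) (a : seq int) :
  (forall y, y \in a -> y <= x) ->
  counts (x :: a) = rcons (counts [seq y <- a | y != x]) (count_mem x a).+1.
Proof.
move=> le_x; set b := filter _ a.
have memb y : (y \in b) = (y != x) && (y \in a) by rewrite mem_filter.
have -> : counts (x :: a)
    = [seq count_mem y (x :: a) | y <- rcons (sort <=%R (undup b)) x].
  congr map; apply: (sorted_eq le_trans le_anti).
  - exact: (sort_sorted le_total).
  - have := sort_sorted le_total (undup b).
    rewrite -cats1 (sorted_pairwise le_trans) (sorted_pairwise le_trans).
    rewrite pairwise_cat => -> /=; rewrite andbT allrel1r; apply/allP => y.
    by rewrite mem_sort mem_undup memb => /andP[_ /le_x].
  rewrite perm_sort; apply: uniq_perm; first exact: undup_uniq.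
    by rewrite rcons_uniq mem_sort mem_undup memb eqxx sort_uniq undup_uniq.
  move=> y; rewrite mem_rcons mem_undup !inE mem_sort mem_undup memb.
  by case: eqP.
rewrite map_rcons /= eqxx add1n; congr rcons; apply/eq_in_map => y.
rewrite mem_sort mem_undup memb => /andP[yx _].
rewrite [x == y]eq_sym (negPf yx) add0n count_filter; apply: eq_count => z /=.
by case: (eqVneq z y) => // ->; rewrite yx.
Qed.

Lemma counts_cons_gt (x : int) (a : seq int) :
  (forall y, y \in a -> y < x) -> counts (x :: a) = rcons (counts a) 1%N.
Proof.
move=> lt_x; rewrite counts_cons; last by move=> y /lt_x /ltW.
have nxa : x \notin a by apply/negP => /lt_x; rewrite ltxx.
rewrite (count_memPn nxa); congr (rcons (counts _) _); apply/all_filterP/allP.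
by move=> y ya; apply: contraNneq nxa => <-.
Qed.

(* For x :: a the weights of a P game without its top player, the first component
   is the quota and x is w_(h-1). *)
Lemma continuant_counts (x : int) (a : seq int) :
  chain (x :: a) -> sorted >=%R (x :: a) ->
  foldl continuant_step (1, 0) (counts (x :: a)) = (weight_sum a + 1, x).
Proof.
elim: a x => [|y a IHa] x.
  by move=> /andP[/eqP-> _] _; rewrite counts_cons // foldl_rcons /weight_sum big_nil.
rewrite [chain _]/= => /andP[xy ch_a] sorted_xa.
have sorted_a := path_sorted sorted_xa.
have le_y z : z \in a -> z <= y.
  by move=> za; have /allP := order_path_min ge_trans sorted_a; apply.
have yx : y <= x by move: sorted_xa => /= /andP[].
have IH := IHa y ch_a sorted_a; rewrite weight_sum_cons.
have [e | neq_xy] := eqVneq x y.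
  rewrite e counts_cons; last first.
    by move=> z; rewrite inE => /predU1P[-> // | /le_y].
  (* Raising the last count by one adds [b], which equals [y], to the first component. *)
  move: IH; rewrite counts_cons //= eqxx /= !foldl_rcons.
  case: (foldl _ _ _) => b c; rewrite /continuant_step /= => -[bc eb].
  by rewrite -addrA -bc eb add1n -!natr1; congr (_, _); ring.
have lt_yx : y < x by rewrite lt_neqAle eq_sym neq_xy.
(* A new type appends the count 1: the old first component becomes the second, and [chain]
   identifies it with [x]. *)
rewrite counts_cons_gt ?foldl_rcons ?IH /continuant_step; last first.
  by move=> z; rewrite inE => /predU1P[-> // | /le_y/le_lt_trans->].
move: xy; rewrite (negPf neq_xy) /= => /eqP ->.
by congr (_, _); rewrite /=; lia.
Qed.

Lemma type_vectorE (T : finType) (w : T -> int) (s : seq T) :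
  perm_eq s (enum T) -> type_vector w = counts (map w s).
Proof.
move=> s_enum; rewrite /type_vector /counts /type_weights.
have -> : sort <=%R (undup (codom w)) = sort <=%R (undup (map w s)).
  apply/(perm_sortP le_total le_trans le_anti)/perm_undup/perm_mem.
  by rewrite perm_sym; apply: perm_map.
apply: eq_map => x; rewrite count_map (permP s_enum) -sum1_count -sum1_card.
by rewrite big_enum_cond /=; apply: eq_bigl => i; rewrite !inE.
Qed.

Lemma coalition_weightT (T : finType) (w : T -> int) (s : seq T) :
  perm_eq s (enum T) -> coalition_weight w [set: T] = weight_sum (map w s).
Proof.
move=> s_enum; rewrite /weight_sum big_map (perm_big _ s_enum) big_enum.
by apply: eq_bigl => i; rewrite !inE.
Qed.

(** * From games to weights, and the quota *)

(** Dropping a player of nonpositive weight keeps a coalition winning, so no minimal winning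
    coalition contains one. *)
Lemma weight_gt0 (N : finType) (v : simple_game N) (q : int) (w : N -> int) :
  minimal_homogeneous_representation v q w -> (forall j, ~ dummy v j) ->
  forall j, 0 < w j.
Proof.
move=> [_ winE _ homog] no_dummy j; case: ltP => // wj.
case: (no_dummy j) => S mS.
apply/negP => jS; have /minsetP[_ /(_ (S :\ j))] := mS.
have := homog S mS; rewrite (coalition_weightD1 _ jS) => wS.
rewrite winE subsetDl => /(_ _ isT) eqS.
have : j \in S :\ j by rewrite eqS //; lia.
by rewrite !inE eqxx.
Qed.

Lemma minimal_winningE (N : finType) (v : simple_game N) (q : int)
    (w : N -> int) (S : {set N}) :
  minimal_homogeneous_representation v q w -> (forall j, 0 < w j) ->
  minimal_winning v S = (coalition_weight w S == q).
Proof.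
move=> [_ winE _ homog] w_gt0; apply/idP/eqP => [/homog // | wS].
apply/minsetP; split=> [|B]; first by rewrite winE wS.
rewrite winE => qB BS; apply/eqP; rewrite eqEsubset BS /=.
apply/subsetP => j jS; apply: contraTT qB => jB.
have BSj : B \subset S :\ j by rewrite subsetD1 BS.
have := coalition_weight_subset w_gt0 BSj; have := w_gt0 j.
by move: wS; rewrite (coalition_weightD1 _ jS) -ltNge; lia.
Qed.

(** If [S] wins but loses without its lightest player, it loses without any of its players; so it is
    minimal winning and weighs exactly [q]. *)
Lemma representation_homogeneous_on (N : finType) (v : simple_game N) (q : int)
    (w : N -> int) (s : seq N) :
  minimal_homogeneous_representation v q w -> (forall j, 0 < w j) ->
  homogeneous_on w s q.
Proof.
move=> [_ winE _ homog] w_gt0 S i _ iS min_i lt_q.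
case: (leP q (coalition_weight w S)) => [qS|]; last exact: ltW.
rewrite homog //; apply/minsetP; split=> [|B]; first by rewrite winE.
rewrite winE => qB BS; apply/eqP; rewrite eqEsubset BS /=.
apply/subsetP => j jS; apply: contraTT qB => jB.
have BSj : B \subset S :\ j by rewrite subsetD1 BS.
have := coalition_weight_subset w_gt0 BSj; have := min_i j jS; move: lt_q.
have := coalition_weightD1 w jS; rewrite (coalition_weightD1 _ iS) -ltNge.
lia.
Qed.

Lemma solutions_minimal_winning (N : finType) (v : simple_game N) (q : int)
    (w : N -> int) (s : seq N) :
  minimal_homogeneous_representation v q w -> (forall j, 0 < w j) ->
  s =i N -> solutions w s q = [set S | minimal_winning v S].
Proof.
move=> rep w_gt0 sN; apply/setP => S; rewrite !inE (minimal_winningE _ rep) //.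
by case: eqP => //= _; rewrite ?andbF ?andbT //; apply/subsetP => i _; rewrite sN.
Qed.

(** The top type has one player. If [x = y], then [y] and the head of [a] both equal the sum of the
    tail of [a] plus one, against [chain] at the head of [a]. *)
Lemma chain_head_lt (x y : int) (a : seq int) :
  chain (y :: a) -> (forall z, z \in y :: a -> 0 < z) ->
  (1 < size a)%N -> y <= x -> x + y = weight_sum a + 1 -> y < x.
Proof.
case: a => [|z [|u a]] // ch pos _ yx.
have u_gt0 : 0 < u by apply: pos; rewrite !inE eqxx !orbT.
have a_ge0 : 0 <= weight_sum a.
  rewrite /weight_sum big_seq; apply: sumr_ge0 => i ia; apply/ltW/pos.
  by rewrite !inE ia !orbT.
move: ch => /= /andP[yz /andP[zu _]]; rewrite !weight_sum_cons in yz zu *.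
by case/orP: yz => /eqP; case/orP: zu => /eqP; lia.
Qed.

(** The top player [x] is treated apart: without it the self-paired state [q] becomes the pair
    [q - w x], [q] on [n - 1] players with [n] solutions, the extremal case. *)
Lemma parsimonious_quota (N : finType) (v : simple_game N) (q p : int)
    (w f : N -> int) :
  parsimonious v -> minimal_homogeneous_representation v q w ->
  minimal_homogeneous_representation v p f ->
  p = q /\ q = continuant (free_type_vector w).
Proof.
move=> [_ n_gt3 no_dummy nmin] rep repf.
have w_gt0 := weight_gt0 rep no_dummy.
have f_gt0 := weight_gt0 repf no_dummy.
pose s := sort (heavier w) (enum N).
have s_enum : perm_eq s (enum N) by rewrite perm_sort.
have us : uniq s by rewrite (perm_uniq s_enum) enum_uniq.
have ss : sorted (heavier w) s by apply: sort_sorted => i j; apply: le_total.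
have sN : s =i N by move=> i; rewrite (perm_mem s_enum) mem_enum.
have hom := representation_homogeneous_on (s := s) rep w_gt0.
have solE := solutions_minimal_winning rep w_gt0 sN.
have nsol : nsolutions w s q = size s.
  by rewrite /nsolutions solE nmin cardE (perm_size s_enum).
have q2 : q + q = weight_sum (map w s) + 1.
  case: rep => _ _ + _; rewrite (coalition_weightT _ s_enum); lia.
have p2 : p + p = weight_sum (map f s) + 1.
  case: repf => _ _ + _; rewrite (coalition_weightT _ s_enum); lia.
have size_s : (3 < size s)%N by rewrite (perm_size s_enum) -cardE.
have fsol : weighs_solutions w f s q p.
  by move=> S; rewrite solE inE (minimal_winningE _ repf) // => /eqP.
have tv : type_vector w = counts (map w s) := type_vectorE w s_enum.
have sorted_w : sorted >=%R (map w s) by rewrite sorted_map.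
rewrite /free_type_vector tv.
(* The lightest player is not a dummy. *)
have [z solv] : exists z, solvable_with_last w z s q.
  have [z zs] : exists z, z \in s.
    by case: (s) size_s => // z t _; exists z; apply: mem_head.
  exists z; have [/exists_inP[S mS lS] | /exists_inPn noS] :=
    boolP [exists S in [set S | minimal_winning v S], last z s \in S].
    by exists S; rewrite ?solE.
  by case: (no_dummy (last z s)) => S mS; apply: noS; rewrite inE.
have q_gt0 : 0 < q.
  have : 0 <= weight_sum (map w s).
    by rewrite /weight_sum big_map; apply: sumr_ge0 => i _; apply: ltW.
  by clear -q2; lia.
have nondeg := nondegenerate_of_solvable w_gt0 us ss q_gt0 q_gt0 q2 hom hom solv.
move: s us ss hom nsol q2 p2 size_s fsol sorted_w nondeg {s_enum sN solE tv solv}.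
case=> [|x [|y s]] // us ss hom nsol q2 p2 size_s fsol sorted_w nondeg.
have [nxs us'] : x \notin y :: s /\ uniq (y :: s) by apply/andP.
have ss' := path_sorted ss.
have nondeg' : nondegenerate (map w (y :: s)) by case/andP: nondeg.
have neq_x := nondegenerate_head nondeg isT.
have x_le := homogeneous_on_head q_gt0 hom.
have x_gt0 := w_gt0 x.
rewrite (map_cons w) weight_sum_cons in q2.
have qx_gt0 : 0 < q - w x by clear -q2 neq_x x_le; lia.
have qx2 : q - w x + q = weight_sum (map w (y :: s)) + 1 by clear -q2; lia.
rewrite nsolutions_cons // in nsol.
have solx (S : {set N}) : S \in solutions w (y :: s) (q - w x) ->
    x \notin S /\ x |: S \in solutions w [:: x, y & s] q.
  move=> /solutionsP[Ss wS]; have nxS := notin_subset nxs Ss; split=> //.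
  apply/solutionsP; split; first exact: subset_setU1_cons.
  by rewrite coalition_weightU1 // wS addrC subrK.
have f1 : weighs_solutions w f (y :: s) (q - w x) (p - f x).
  move=> S /solx[nxS /fsol]; rewrite coalition_weightU1 // => <-.
  by rewrite addrC addKr.
have f2 : weighs_solutions w f (y :: s) q p.
  move=> S /solutionsP[Ss wS]; apply/fsol/solutionsP.
  by split; first exact: subset_consW.
have [ch hd [c [fc pc1 pc2]]] := chain_of_nsolutions_pair w_gt0 us' ss' nondeg'
  qx_gt0 q_gt0 qx2 (homogeneous_on_take nxs ss hom) (homogeneous_on_tail hom)
  nsol f1 f2.
have yx : w y <= w x by apply: (sorted_heavier_head ss); apply: mem_head.
(* The alternative [q = w y] fails because [w y <= w x < q]. *)
have qxy : q = w x + w y by clear -hd qx_gt0 yx; case: hd; lia.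
have qs : q = weight_sum (map w s) + 1.
  by move: qx2; rewrite map_cons weight_sum_cons; clear -qxy; lia.
have lt_yx : w y < w x.
  apply: chain_head_lt ch _ _ yx _.
    by move=> u; rewrite -(map_cons w) => /mapP[i _ ->].
    by rewrite size_map.
  by rewrite -qxy.
split.
  have fx : f x = c * w x by move: pc1; rewrite pc2 mulrBr; clear; lia.
  have fsum : weight_sum (map f [:: x, y & s])
              = c * weight_sum (map w [:: x, y & s]).
    rewrite /weight_sum !big_map big_distrr /=; apply: eq_big_seq => i.
    by rewrite inE => /predU1P[-> | /fc].
  (* Both representations have twice the quota equal to the total weight plus one, which fixes the
     factor. *)
  have c1 : c = 1.
    move: p2; rewrite fsum map_cons weight_sum_cons pc2 => p2.
    have : c * (q + q) = c * (w x + weight_sum (map w (y :: s)) + 1).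
      by rewrite q2.
    by rewrite mulrDr mulrDr p2 mulr1; clear; lia.
  by rewrite pc2 c1 mul1r.
(* The dropped last count is that of [x] alone; the rest is the counts of [y :: s], with continuant
   [weight_sum (map w s) + 1]. *)
rewrite map_cons counts_cons_gt; last first.
  move=> _ /mapP[i + ->]; rewrite inE => /predU1P[-> // | si].
  by apply: le_lt_trans lt_yx; apply: (sorted_heavier_head ss').
rewrite -cats1 size_cat addn1 /= take_size_cat // /continuant.
by rewrite continuant_counts // (path_sorted sorted_w).
Qed.

Theorem theorem8p1 (N N' : finType) (v : simple_game N) (v' : simple_game N')
    (q q' : int) (hv : parsimonious v) (hv' : parsimonious v')
    (htwins : twins v v')
    (hq : minimal_winning_quota v q) (hq' : minimal_winning_quota v' q') :
  q = q'.
Proof.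
case: htwins => a [b [[r [w [rep ->]]] [r' [w' [rep' ->]]] eq_size _ sym]].
case: hq hq' => [f repf] [f' repf'].
have [-> ->] := parsimonious_quota hv rep repf.
have [-> ->] := parsimonious_quota hv' rep' repf'.
(* The twin condition makes one free type vector the reversal of the other. *)
rewrite -[RHS]continuant_rev; congr continuant.
apply: (@eq_from_nth _ 0%N) => [|t lt_t]; first by rewrite size_rev.
by rewrite nth_rev -?eq_size // sym.
Qed.
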